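(* Let $(X,r)$ be a finite involutive (non-degenerate, set-theoretic) solution to the Yang--Baxter equation. Then the structure group $G(X,r)$ is a Bieberbach group with holonomy group isomorphic to the permutation group $\mathcal{G}(X,r)$.
   Context: A solution is a pair $(X,r)$ where $X$ is a set and $r\colon X\times X\to X\times X$ is a bijective map, written $r(x,y)=(\sigma_x(y),\tau_y(x))$, such that $(r\times\mathrm{id})(\mathrm{id}\times r)(r\times\mathrm{id})=(\mathrm{id}\times r)(r\times\mathrm{id})(\mathrm{id}\times r)$ and all maps $\sigma_x,\tau_x\colon X\to X$ are permutations (non-degeneracy). It is finite if $X$ is finite, and involutive if $r^2=\mathrm{id}$. The structure group $G(X,r)$ is the group with generators the elements $x\in X$ and relations $x\circ y=u\circ v$ whenever $r(x,y)=(u,v)$. For an involutive solution, the permutation group $\mathcal{G}(X,r)$ is the subgroup of the group of permutations of $X$ generated by $\{\sigma_x:x\in X\}$. A group $G$ is an $n$-dimensional Bieberbach group if it is torsion-free and contains an abelian normal subgroup $A\simeq\mathbb{Z}^n$ of finite index such that $C_G(A)=A$, where $C_G(A)$ is the centralizer of $A$ in $G$. The finite group $G/A$ is called the holonomy group of $G$. *)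

(* Defs.v *)
From HB Require Import structures.
From mathcomp Require Import all_boot all_order all_algebra all_fingroup.
From mathcomp Require Import boolp classical_sets functions cardinality.
(* Imported last: fingroup also has a [repr]. *)
From mathcomp Require Import generic_quotient.

Set Implicit Arguments.
Unset Strict Implicit.
Unset Printing Implicit Defensive.

Local Open Scope group_scope.
Local Open Scope quotient_scope.

Definition isomorphic (G H : groupType) : Prop :=
  exists f : {multiplicative G -> H}, bijective f.

Definition torsion_free (G : groupType) : Prop :=
  forall (x : G) (k : nat), (0 < k)%N -> x ^+ k = 1 -> x = 1.

Record normalSubgroup (G : groupType) := NormalSubgroup {
  nsub :> groupClosed G;
  nsub_conj : forall a g : G, a \in nsub -> a ^ g \in nsub
}.

Section SubgroupType.
Variables (G : groupType) (A : groupClosed G).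

Inductive subgroup_type : predArgType := Subgroup x & x \in A.
Definition subgroup_val (u : subgroup_type) := let: Subgroup x _ := u in x.

HB.instance Definition _ := [isSub for subgroup_val].
HB.instance Definition _ := [Choice of subgroup_type by <:].

Lemma subgroup_closed : group_closed (fun x : G => x \in A).
Proof.
split; first by rewrite unfold_in; exact: gpred1.
move=> x y; rewrite !unfold_in => Ax Ay.
by apply: (gpredM (s := A)) => //; apply: (gpredVr (s := A)).
Qed.

HB.instance Definition _ :=
  SubChoice_isSubGroup.Build G (fun x => x \in A) subgroup_type subgroup_closed.

End SubgroupType.

Section QuotientGroup.
Variables (G : groupType) (A : normalSubgroup G).

Definition coset_rel : rel G := fun x y => x^-1 * y \in A.

Lemma coset_rel_refl : reflexive coset_rel.
Proof. by move=> x; rewrite /coset_rel mulVg gpred1. Qed.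

Lemma coset_rel_sym : symmetric coset_rel.
Proof.
have H x y : coset_rel x y -> coset_rel y x.
  by rewrite /coset_rel => /(gpredVr (s := A)); rewrite invgM invgK.
by move=> x y; apply/idP/idP; apply: H.
Qed.

Lemma coset_rel_trans : transitive coset_rel.
Proof.
move=> y x z; rewrite /coset_rel => Axy Ayz.
by have := gpredM (s := A) _ _ Axy Ayz; rewrite mulgA mulgK.
Qed.

Lemma coset_rel_mul x x' y y' :
  coset_rel x x' -> coset_rel y y' -> coset_rel (x * y) (x' * y').
Proof.
rewrite /coset_rel => Ax Ay.
have := gpredM (s := A) _ _ (nsub_conj y Ax) Ay.
by rewrite /conjg invgM !mulgA mulgK.
Qed.

Lemma coset_rel_inv x y : coset_rel x y -> coset_rel x^-1 y^-1.
Proof.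
rewrite coset_rel_sym /coset_rel => Axy.
have := nsub_conj y^-1 Axy.
by rewrite /conjg !invgK !mulgA mulgV mul1g.
Qed.

Canonical coset_equiv :=
  EquivRel coset_rel coset_rel_refl coset_rel_sym coset_rel_trans.

Definition quot_group := {eq_quot coset_equiv}.
HB.instance Definition _ := Choice.on quot_group.
HB.instance Definition _ := EqQuotient.on quot_group.

Definition quot_mul (u v : quot_group) : quot_group :=
  \pi_quot_group (repr u * repr v).
Definition quot_inv (u : quot_group) : quot_group := \pi_quot_group (repr u)^-1.

Lemma quot_repr x : coset_rel (repr (\pi_quot_group x)) x.
Proof. by have /eqmodP := reprK (\pi_quot_group x). Qed.

Lemma quot_mulE x y :
  quot_mul (\pi_quot_group x) (\pi_quot_group y) = \pi_quot_group (x * y).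
Proof. by apply/eqmodP/coset_rel_mul; apply: quot_repr. Qed.

Lemma quot_invE x : quot_inv (\pi_quot_group x) = \pi_quot_group x^-1.
Proof. by apply/eqmodP/coset_rel_inv/quot_repr. Qed.

Lemma quot_mulA : associative quot_mul.
Proof.
elim/quotW=> x; elim/quotW=> y; elim/quotW=> z.
by rewrite (quot_mulE y z) (quot_mulE x y) !quot_mulE mulgA.
Qed.

Lemma quot_mul1 : left_id (\pi_quot_group 1) quot_mul.
Proof. by elim/quotW=> x; rewrite quot_mulE mul1g. Qed.

Lemma quot_1mul : right_id (\pi_quot_group 1) quot_mul.
Proof. by elim/quotW=> x; rewrite quot_mulE mulg1. Qed.

Lemma quot_mulV : left_inverse (\pi_quot_group 1) quot_inv quot_mul.
Proof. by elim/quotW=> x; rewrite quot_invE quot_mulE mulVg. Qed.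

Lemma quot_Vmul : right_inverse (\pi_quot_group 1) quot_inv quot_mul.
Proof. by elim/quotW=> x; rewrite quot_invE quot_mulE mulgV. Qed.

HB.instance Definition _ := isGroup.Build quot_group
  quot_mulA quot_mul1 quot_1mul quot_mulV quot_Vmul.

End QuotientGroup.

Section Presentation.
Variable X : choiceType.

(* The letter (x, true) stands for x and (x, false) for its inverse. *)
Definition word := seq (X * bool).

Definition word_inv (w : word) : word := rev [seq (p.1, ~~ p.2) | p <- w].

Variable R : word -> word -> Prop.

Inductive word_eq : word -> word -> Prop :=
| word_eq_rel u v of R u v : word_eq u v
| word_eq_cancel x b : word_eq [:: (x, b); (x, ~~ b)] [::]
| word_eq_refl u : word_eq u u
| word_eq_sym u v of word_eq u v : word_eq v u
| word_eq_trans u v w of word_eq u v & word_eq v w : word_eq u w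
| word_eq_cat u u' v v' of word_eq u u' & word_eq v v' :
    word_eq (u ++ v) (u' ++ v').

Definition word_eqb : rel word := fun u v => `[< word_eq u v >].

Lemma word_eqb_refl : reflexive word_eqb.
Proof. by move=> u; apply/asboolP/word_eq_refl. Qed.

Lemma word_eqb_sym : symmetric word_eqb.
Proof.
by move=> u v; apply/idP/idP => /asboolP ?; apply/asboolP/word_eq_sym.
Qed.

Lemma word_eqb_trans : transitive word_eqb.
Proof.
by move=> v u w /asboolP uv /asboolP vw; apply/asboolP/(word_eq_trans uv vw).
Qed.

Lemma word_invK : involutive word_inv.
Proof.
move=> u; rewrite /word_inv map_rev revK -map_comp map_id_in //.
by case=> x b _ /=; rewrite negbK.
Qed.

Lemma word_mulV u : word_eq (u ++ word_inv u) [::].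
Proof.
elim: u => [|[x b] u IH]; first exact: word_eq_refl.
rewrite /word_inv /= rev_cons -/(word_inv u) -cats1 catA.
apply: word_eq_trans (word_eq_cancel x b).
exact: (word_eq_cat (word_eq_refl [:: (x, b)])
                    (word_eq_cat IH (word_eq_refl [:: (x, ~~ b)]))).
Qed.

Lemma word_Vmul u : word_eq (word_inv u ++ u) [::].
Proof. by rewrite -{2}[u]word_invK; apply: word_mulV. Qed.

Canonical word_equiv :=
  EquivRel word_eqb word_eqb_refl word_eqb_sym word_eqb_trans.

Definition presented_group := {eq_quot word_equiv}.
HB.instance Definition _ := Choice.on presented_group.
HB.instance Definition _ := EqQuotient.on presented_group.

Definition pres_one : presented_group := \pi_presented_group [::].
Definition pres_mul (g h : presented_group) : presented_group :=
  \pi_presented_group (repr g ++ repr h).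
Definition pres_inv (g : presented_group) : presented_group :=
  \pi_presented_group (word_inv (repr g)).

Lemma pres_eqP u v :
  reflect (word_eq u v) (\pi_presented_group u == \pi_presented_group v).
Proof. by rewrite eqmodE; apply: asboolP. Qed.

Lemma pres_repr u : word_eq (repr (\pi_presented_group u)) u.
Proof. by apply/pres_eqP; rewrite reprK. Qed.

Lemma pres_mulE u v :
  pres_mul (\pi_presented_group u) (\pi_presented_group v)
  = \pi_presented_group (u ++ v).
Proof. by apply/eqP/pres_eqP/word_eq_cat; apply: pres_repr. Qed.

Lemma pres_mulA : associative pres_mul.
Proof.
elim/quotW=> u; elim/quotW=> v; elim/quotW=> w.
by rewrite (pres_mulE v w) (pres_mulE u v) !pres_mulE catA.
Qed.

Lemma pres_mul1 : left_id pres_one pres_mul.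
Proof. by elim/quotW=> u; rewrite pres_mulE. Qed.

Lemma pres_1mul : right_id pres_one pres_mul.
Proof. by elim/quotW=> u; rewrite pres_mulE cats0. Qed.

Lemma pres_mulV : left_inverse pres_one pres_inv pres_mul.
Proof.
move=> g; rewrite -{2}[g]reprK pres_mulE.
by apply/eqP/pres_eqP/word_Vmul.
Qed.

Lemma pres_Vmul : right_inverse pres_one pres_inv pres_mul.
Proof.
move=> g; rewrite -{1}[g]reprK pres_mulE.
by apply/eqP/pres_eqP/word_mulV.
Qed.

HB.instance Definition _ := isGroup.Build presented_group
  pres_mulA pres_mul1 pres_1mul pres_mulV pres_Vmul.

End Presentation.

Section YangBaxter.
Variables (X : Type) (r : X * X -> X * X).

Definition r12 (t : X * X * X) : X * X * X := (r t.1, t.2).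
Definition r23 (t : X * X * X) : X * X * X :=
  let: (y, z) := r (t.1.2, t.2) in (t.1.1, y, z).

Definition sigma (x y : X) : X := (r (x, y)).1.
Definition tau (y x : X) : X := (r (x, y)).2.

End YangBaxter.

Record solution (X : Type) := Solution {
  sol_map :> X * X -> X * X;
  sol_bij : bijective sol_map;
  sol_braid : r12 sol_map \o r23 sol_map \o r12 sol_map
              =1 r23 sol_map \o r12 sol_map \o r23 sol_map;
  sol_sigma_bij : forall x, bijective (sigma sol_map x);
  sol_tau_bij : forall y, bijective (tau sol_map y)
}.

Section StructureGroup.
Variables (X : choiceType) (s : solution X).

Inductive structure_relation : word X -> word X -> Prop :=
| StructureRelation x y u v of s (x, y) = (u, v) :
    structure_relation [:: (x, true); (y, true)] [:: (u, true); (v, true)].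

Definition structure_group : groupType := presented_group structure_relation.

End StructureGroup.

Section PermutationGroup.
Variables (X : finType) (s : solution X).

Definition sigma_perm (x : X) : {perm X} := perm (bij_inj (sol_sigma_bij s x)).

(* The product of {perm X} is composition in the reverse order; as a set the
   generated subgroup does not depend on this, and inversion is an isomorphism
   between the two group structures. *)
Definition permutation_group : {group {perm X}} :=
  <<[set sigma_perm x | x : X]>>%G.

End PermutationGroup.

Record bieberbach (n : nat) (G : groupType) (A : normalSubgroup G) : Prop :=
  Bieberbach {
  bieb_torsion_free : torsion_free G;
  bieb_abelian : {in A &, forall a b, commute a b};
  bieb_rank : isomorphic (subgroup_type A) (Algebra.to_multiplicative 'rV[int]_n);
  bieb_index : finite_set [set: quot_group A]%classic;
  bieb_centralizer :
    ([set g | {in A, forall a, commute g a}] = [set` A])%classic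
}.

(* Main.v *)
Require Import Defs.
From HB Require Import structures.
From mathcomp Require Import all_boot all_order all_algebra all_fingroup.
From mathcomp Require Import boolp classical_sets cardinality.
From mathcomp Require Import generic_quotient.

Set Implicit Arguments.
Unset Strict Implicit.
Unset Printing Implicit Defensive.

(** The structure group G is realised as a group of affine maps of the lattice
    Z^X.  The generator x acts as translation by the basis vector e_x composed
    with the permutation of coordinates given by sigma_x; involutivity makes the
    translation parts agree on both sides of a defining relation, and the braid
    equation makes the linear parts agree ([structure_affine]).  Write the action
    of g, on functions w from X to Z, as w |-> t(g) + w o hol(g); so t(g) is the
    image of 0, and hol(x) = sigma_x^-1 for a generator x.

    The key fact is that this action is simply transitive on Z^X, that is, t is
    bijective ([transl_bijective]).  Right multiplication of g by the generator
    hol(g)(y) moves t(g) to t(g) + e_y.  These operations of G are invertible,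
    because x |-> sigma_x^-1(x) is a bijection of X ([diagonal_inj]), and they
    commute with one another, thanks to the defining relations
    ([gen_commute]).  So they make Z^X act on the set G, and the orbit map of 1
    is inverse to t.

    Everything else holds for any group G acting simply transitively on Z^X by
    translations composed with coordinate permutations, with A the subgroup of
    translations.
    - Torsion: the action preserves the coordinatewise order, so the
      coordinatewise minimum of a finite orbit is fixed by a cyclic group; it is
      a lattice point, and stabilisers are trivial
      ([simply_transitive_torsion_free]).
    - A embeds in Z^X through t, so it is free abelian of finite rank
      ([int_subgroup_basis], [free_abelian_of_embedding]).
    - G / A is isomorphic to the finite image of hol ([quotient_isomorphic]),
      which for the structure group is the permutation group
      ([holonomy_image]).
    - As hol has finite image, A contains a nonzero multiple of each basis
      vector ([translations_unit_vec]); an element commuting with these has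
      trivial linear part ([translations_self_centralizing]). *)

Import Order.TTheory GRing.Theory Num.Theory.
Local Open Scope group_scope.
Local Open Scope quotient_scope.

(** * Subgroups of a free abelian group of finite rank *)

Section Lattice.
Local Open Scope ring_scope.

Lemma closed_intmul (V : zmodType) (B : V -> Prop) (v : V) :
    B 0 -> (forall u w, B u -> B w -> B (u - w)) -> B v ->
  forall q : int, B (v *~ q).
Proof.
move=> B0 BB Bv.
have Bn k : B (- (v *+ k)).
  by elim: k => [|k IH]; rewrite ?mulr0n ?oppr0// mulrS opprD addrC; apply: BB.
case=> k; last exact: Bn.
by rewrite -[v *~ _]opprK -sub0r; apply: BB => //; apply: Bn.
Qed.

(** Induction on the rank: either all first coordinates vanish on B and the last n
    carry everything, or the vectors of B with zero first coordinate have as a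
    complement in B the multiples of any b in B whose first coordinate is the
    least positive one. *)
Lemma int_subgroup_basis n (B : 'rV[int]_n -> Prop) :
    B 0 -> (forall u v, B u -> B v -> B (u - v)) ->
  exists m (M : 'M[int]_(m, n)),
    (forall v, B v <-> exists u, v = u *m M) /\
    injective (fun u : 'rV_m => u *m M).
Proof.
elim: n B => [|n IH].
  move=> B B0 BB.
  exists 0, 0; split=> [v|u v _]; last by rewrite [u]thinmx0 [v]thinmx0.
  by split=> [_|_]; [exists 0; rewrite !thinmx0 | rewrite [v]thinmx0].
rewrite -[n.+1]/(1 + n)%N => B B0 BB.
have [||m [M [MB Minj]]] := IH (fun v => B (row_mx (0 : 'M_1) v)).
- by rewrite row_mx0.
- by move=> u v Bu Bv; have := BB _ _ Bu Bv; rewrite opp_row_mx add_row_mx subr0.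
pose N : 'M_(m, 1 + n) := row_mx 0 M.
have mulN (u : 'rV_m) : u *m N = row_mx 0 (u *m M) by rewrite mul_mx_row mulmx0.
have NB w : B w -> lsubmx w = 0 -> exists u, w = u *m N.
  move=> Bw w0; have wE : w = row_mx 0 (rsubmx w) by rewrite -{1}[w]hsubmxK w0.
  have /MB[u uM] : B (row_mx 0 (rsubmx w)) by rewrite -wE.
  by exists u; rewrite mulN -uM.
have BN u : B (u *m N) by rewrite mulN; apply/MB; exists u.
(* A positive first coordinate is written d.+1, so that its minimality is over
   all natural numbers d. *)
pose P d := `[< exists v : 'rV_n, B (row_mx (d.+1%:Z)%:M v) >].
have [[d Pd]|noP] := pselect (exists d, P d); last first.
  exists m, N; split=> [w|u u']; last by rewrite !mulN => /eq_row_mx[_ /Minj].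
  split=> [Bw|[u ->]//]; apply: NB => //.
  (* A negative first coordinate of w is a positive one of - w. *)
  have posF w' (d : nat) : B w' -> lsubmx w' = (d.+1%:Z)%:M -> False.
    move=> Bw' e; apply: noP; exists d; apply/asboolP.
    by exists (rsubmx w'); rewrite -e hsubmxK.
  rewrite [lsubmx _]mx11_scalar; case E: (lsubmx _ 0 0) => [[|k]|k].
  - by rewrite raddf0.
  - by case: (posF w k Bw); rewrite [lsubmx _]mx11_scalar E.
  - case: (posF (0 - w) k); first exact: BB.
    rewrite sub0r linearN /= [lsubmx _]mx11_scalar E NegzE -(raddfN (@scalar_mx _ 1)).
    by rewrite opprK.
have exP : exists d, P d by exists d.
case: (ex_minnP exP) => {Pd} {}d /asboolP[v Bb] dmin.
set b : 'rV_(1 + n) := row_mx _ v in Bb.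
exists (1 + m)%N, (col_mx b N).
have mulM (u : 'rV_(1 + m)) : u *m col_mx b N = b *~ (lsubmx u 0 0) + rsubmx u *m N.
  rewrite -{1}[u]hsubmxK mul_row_col; congr (_ + _).
  by rewrite {1}[lsubmx u]mx11_scalar mul_scalar_mx -[X in X *: _]intz scaler_int.
have Bq q : B (b *~ q) by apply: closed_intmul.
have bl q : lsubmx (b *~ q) = (q * d.+1%:Z)%:M.
  rewrite -scaler_int intz linearZ /= row_mxKl.
  by rewrite -mul_scalar_mx -scalar_mxM.
have Nl (u : 'rV_m) : lsubmx (u *m N) = 0 by rewrite mulN row_mxKl.
split=> [w|u u'].
  split=> [Bw|[u ->]]; last first.
    rewrite mulM -[X in _ + X]opprK; apply: (BB) => //.
    by rewrite -sub0r; apply: BB.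
  pose a := lsubmx w 0 0.
  pose q := (a %/ d.+1%:Z)%Z.
  have aE : a = q * d.+1%:Z + (a %% d.+1%:Z)%Z by exact: divz_eq.
  have Br : B (w - b *~ q) by apply: BB.
  have rl : lsubmx (w - b *~ q : 'rV_(1 + n)) = (a %% d.+1%:Z)%Z%:M.
    rewrite linearB /= bl [lsubmx w]mx11_scalar -/a {1}aE.
    by rewrite raddfD /= addrAC subrr add0r.
  have [|u uE] := NB _ Br.
    rewrite rl; case E: (a %% d.+1%:Z)%Z => [[|k]|k].
    - by rewrite raddf0.
    - have /dmin : P k.
        apply/asboolP; exists (rsubmx (w - b *~ q : 'rV_(1 + n))).
        by rewrite -E -rl hsubmxK.
      by have := ltz_pmod a (isT : 0 < d.+1%:Z); rewrite E ltz_nat ltnS ltnNge => /negP.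
    - by have := modz_ge0 a (isT : d.+1%:Z != 0); rewrite E.
  exists (row_mx q%:M u); rewrite mulM row_mxKl row_mxKr mxE mulr1n -uE.
  by rewrite addrC subrK.
rewrite !mulM => e.
have l_eq : lsubmx u = lsubmx u'.
  have := congr1 (fun w : 'rV_(1 + n) => lsubmx w 0 0) e.
  rewrite !linearD /= !Nl !addr0 !bl !mxE !mulr1n => /(mulIf _) l.
  by apply/matrixP => i j; rewrite !ord1 !mxE; apply: l.
rewrite -[u]hsubmxK -[u']hsubmxK l_eq; congr row_mx.
by apply: Minj; move: e; rewrite l_eq => /addrI; rewrite !mulN => /eq_row_mx[].
Qed.

End Lattice.

Lemma free_abelian_of_embedding (X : finType) (A : groupType)
    (f : A -> {ffun X -> int}) :
    injective f -> {morph f : a b / a * b >-> (a + b)%R} ->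
  exists n, isomorphic A (Algebra.to_multiplicative 'rV[int]_n).
Proof.
move=> f_inj fM.
pose h a : 'rV[int]_#|X| := (\row_i f a (enum_val i))%R.
have hM a b : h (a * b) = (h a + h b)%R.
  by apply/rowP=> i; rewrite !mxE fM ffunE.
have h_inj : injective h.
  move=> a b /rowP e; apply/f_inj/ffunP=> x.
  by have := e (enum_rank x); rewrite !mxE enum_rankK.
have h1 : h 1 = 0%R by apply: (@addrI _ (h 1)); rewrite -hM mulg1 addr0.
have hV a : h a^-1 = (- h a)%R by apply: (@addrI _ (h a)); rewrite -hM mulgV h1 subrr.
have [||n [M [hB Minj]]] := @int_subgroup_basis _ (fun v => exists a, h a = v).
- by exists 1.
- by move=> _ _ [a <-] [b <-]; exists (a * b^-1); rewrite hM hV.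
(* The coordinates of h a in the basis M. *)
have /choice[c cP] a : exists u : 'rV_n, h a = (u *m M)%R.
  by apply/hB; exists a.
have cM : {morph c : a b / a * b >-> (a : Algebra.to_multiplicative _) * b}.
  by move=> a b; apply: Minj; rewrite /= -cP hM !cP -mulmxDl.
exists n.
pose mc := isMultiplicative.Build A (Algebra.to_multiplicative 'rV[int]_n) c cM.
pose F : {multiplicative A -> Algebra.to_multiplicative 'rV[int]_n} := HB.pack c mc.
have /choice[d dP] u : exists a, h a = (u *m M)%R by apply/hB; exists u.
exists F, d => [a|u]; first by apply: h_inj; rewrite dP -cP.
by apply: Minj; rewrite /= -cP dP.
Qed.

(** * Translations composed with coordinate permutations *)

Section Affine.
Variable X : finType.
Implicit Types (v w : {ffun X -> int}) (p q : {perm X}).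
Local Open Scope ring_scope.

Definition twist v p : {ffun X -> int} := [ffun z => v (p z)].

Lemma twistD v w p : twist (v + w) p = twist v p + twist w p.
Proof. by apply/ffunP=> z; rewrite !ffunE. Qed.

Lemma twistN v p : twist (- v) p = - twist v p.
Proof. by apply/ffunP=> z; rewrite !ffunE. Qed.

Lemma twist0 p : twist 0 p = 0.
Proof. by apply/ffunP=> z; rewrite !ffunE. Qed.

Lemma twist1 v : twist v 1%g = v.
Proof. by apply/ffunP=> z; rewrite !ffunE perm1. Qed.

Lemma twistM v p q : twist v (p * q)%g = twist (twist v q) p.
Proof. by apply/ffunP=> z; rewrite !ffunE permM. Qed.

Definition affine_group : Type := ({ffun X -> int} * {perm X})%type.
HB.instance Definition _ := Choice.on affine_group.

(** The pair (v, p) stands for the affine map w |-> v + twist w p.  Since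
    permutations compose from left to right and [twist] is contravariant, the
    composition of affine maps multiplies the permutations in the same order. *)
Definition aff_mul (a b : affine_group) : affine_group :=
  (a.1 + twist b.1 a.2, a.2 * b.2)%g.
Definition aff_inv (a : affine_group) : affine_group :=
  (- twist a.1 a.2^-1, a.2^-1)%g.

Lemma aff_mulA : associative aff_mul.
Proof.
by move=> a b c; rewrite /aff_mul /= twistD twistM addrA mulgA.
Qed.

Lemma aff_mul1 : left_id (0, 1%g) aff_mul.
Proof. by case=> v p; rewrite /aff_mul /= twist1 add0r mul1g. Qed.

Lemma aff_1mul : right_id (0, 1%g) aff_mul.
Proof. by case=> v p; rewrite /aff_mul /= twist0 addr0 mulg1. Qed.

Lemma aff_mulV : left_inverse (0, 1%g) aff_inv aff_mul.
Proof. by case=> v p; rewrite /aff_mul /= addNr mulVg. Qed.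

Lemma aff_Vmul : right_inverse (0, 1%g) aff_inv aff_mul.
Proof.
by case=> v p; rewrite /aff_mul /= twistN -twistM mulgV twist1 subrr.
Qed.

HB.instance Definition _ := isGroup.Build affine_group
  aff_mulA aff_mul1 aff_1mul aff_mulV aff_Vmul.

Definition unit_vec (x : X) : {ffun X -> int} := [ffun z => (z == x)%:R].

Lemma twist_unit_vec p x : twist (unit_vec (p x)) p = unit_vec x.
Proof. by apply/ffunP=> z; rewrite !ffunE (inj_eq perm_inj). Qed.

Lemma unit_vecMz x (n : int) z : (unit_vec x *~ n) z = (z == x)%:R * n.
Proof.
by rewrite -mulrzz; case: n => n; rewrite /intmul ?ffunE ffunMnE ffunE.
Qed.

End Affine.

(** * Groups acting simply transitively on the lattice *)

Section SimplyTransitive.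
Variables (X : finType) (G : groupType) (F : UMagmaMorphism.type G (affine_group X)).

Definition transl (g : G) : {ffun X -> int} := (F g).1.
Definition holonomy (g : G) : {perm X} := (F g).2.

Lemma translM g h : transl (g * h) = (transl g + twist (transl h) (holonomy g))%R.
Proof. by rewrite /transl gmulfM. Qed.

Lemma holonomyM g h : holonomy (g * h) = holonomy g * holonomy h.
Proof. by rewrite /holonomy gmulfM. Qed.

Lemma holonomy1 : holonomy 1 = 1.
Proof. by rewrite /holonomy gmulf1. Qed.

Lemma transl1 : transl 1 = 0%R.
Proof. by rewrite /transl gmulf1. Qed.

Lemma holonomyV g : holonomy g^-1 = (holonomy g)^-1.
Proof. by rewrite /holonomy gmulfV. Qed.

Lemma transl_div g h : holonomy g = holonomy h ->
  transl (g * h^-1) = (transl g - transl h)%R.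
Proof.
move=> e; apply: (@addIr _ (transl h)); rewrite subrK.
rewrite -{2}[g](mulgVK h).
by rewrite [RHS]translM holonomyM holonomyV e mulgV twist1.
Qed.

Definition transl_kernel : {pred G} := fun g => holonomy g == 1.

Lemma transl_kernelP g : reflect (holonomy g = 1) (g \in transl_kernel).
Proof. exact: eqP. Qed.

Fact transl_kernelM : mulg_closed transl_kernel.
Proof.
move=> g h /transl_kernelP gK /transl_kernelP hK; apply/transl_kernelP.
by rewrite holonomyM gK hK mulg1.
Qed.

Fact transl_kernel1 : 1 \in transl_kernel.
Proof. by apply/transl_kernelP/holonomy1. Qed.

Fact transl_kernelV : invg_closed transl_kernel.
Proof.
by move=> g /transl_kernelP gK; apply/transl_kernelP; rewrite holonomyV gK invg1.
Qed.

HB.instance Definition _ := isMulClosed.Build G transl_kernel transl_kernelM.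
HB.instance Definition _ := isMul1Closed.Build G transl_kernel transl_kernel1.
HB.instance Definition _ := isInvClosed.Build G transl_kernel transl_kernelV.

Fact transl_kernelJ (a g : G) : a \in transl_kernel -> a ^ g \in transl_kernel.
Proof.
move=> /transl_kernelP aK; apply/transl_kernelP.
by rewrite conjgE !holonomyM aK mul1g holonomyV mulVg.
Qed.

Definition translations : normalSubgroup G :=
  @NormalSubgroup G transl_kernel transl_kernelJ.

Lemma translationsP g : reflect (holonomy g = 1) (g \in translations).
Proof. exact: transl_kernelP. Qed.

(** The first isomorphism theorem for the linear part. *)
Lemma quotient_isomorphic (P : {group {perm X}}) :
    (forall p, (p \in P) <-> exists g, holonomy g = p) ->
  isomorphic (quot_group translations) (subg_of P).
Proof.
move=> imP.
have linP g : holonomy g \in P by apply/imP; exists g.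
pose f (u : quot_group translations) : subg_of P := Subg (linP (repr u)).
have fE g : val (f (\pi_(quot_group translations) g)) = holonomy g.
  have /translationsP := @quot_repr _ translations g.
  by rewrite holonomyM holonomyV => /(canRL (mulKVg _)); rewrite mulg1 => ->.
have fM : {morph f : u v / u * v}.
  elim/quotW=> g; elim/quotW=> h; apply/val_inj.
  by rewrite [X in f X]quot_mulE fE holonomyM -!fE.
pose mf := isMultiplicative.Build _ _ f fM.
pose Fq : {multiplicative quot_group translations -> subg_of P} := HB.pack f mf.
have f_inj : injective f.
  elim/quotW=> g; elim/quotW=> h /(congr1 val); rewrite !fE => e.
  by apply/eqmodP/translationsP; rewrite holonomyM holonomyV e mulVg.
have /choice[k kP] (p : subg_of P) : exists g, holonomy g = val p.
  by apply/imP/valP.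
have kfK p : f (\pi_(quot_group translations) (k p)) = p.
  by apply/val_inj; rewrite fE.
by exists Fq, (fun p => \pi_(quot_group translations) (k p)) => [u|p];
  [apply: f_inj|]; exact: kfK.
Qed.

(** As transl g is the image of 0, bijectivity means that the action on the lattice
    is simply transitive. *)
Hypothesis transl_bij : bijective transl.

Let transl_inj : injective transl := bij_inj transl_bij.

(** The coordinatewise minimum w of the orbit of 0 under the powers of g is a
    lattice point fixed by g, because g preserves the coordinatewise order; simple
    transitivity then gives g = 1. *)
Lemma simply_transitive_torsion_free : torsion_free G.
Proof.
move=> g [//|k] _ gk1.
have gmod i : g ^+ i = g ^+ (i %% k.+1).
  by rewrite {1}(divn_eq i k.+1) expgnDr mulnC expgnA gk1 expg1n mul1g.
pose t i z := transl (g ^+ i) z.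
pose w : {ffun X -> int} := [ffun z => t [arg min_(i < ord0 : 'I_k.+1) t i z]%O z].
have w_le i z : (w z <= t i z)%R.
  rewrite /w ffunE; case: arg_minP => // j _ jmin.
  have := jmin (Ordinal (ltn_pmod i (ltn0Sn k))) isT.
  by rewrite /t -gmod.
have w_in z : exists i, w z = t i z.
  by rewrite /w ffunE; eexists.
clearbody w.
have tS i z : t i.+1 z = (transl g z + t i (holonomy g z))%R.
  by rewrite /t expgS translM !ffunE.
have fixw : (transl g + twist w (holonomy g))%R = w.
  apply/ffunP=> z; rewrite !ffunE; apply/eqP; rewrite eq_le; apply/andP; split.
    have [i ->] := w_in z.
    (* Every exponent is a successor modulo k.+1, also i = 0. *)
    have -> : t i z = t (i + k).+1 z.
      by rewrite /t gmod -addnS -modnDr -gmod.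
    by rewrite tS lerD2l.
  by have [i ->] := w_in (holonomy g z); rewrite -tS.
have [h hK tK] := transl_bij.
by apply: (mulIg (h w)); apply: transl_inj; rewrite translM tK mul1g tK.
Qed.

Lemma translations_commute : {in translations &, forall a b, commute a b}.
Proof.
move=> a b /translationsP aK /translationsP bK; apply: transl_inj.
by rewrite !translM aK bK !twist1 addrC.
Qed.

Lemma translations_rank :
  exists n, isomorphic (subgroup_type translations)
                       (Algebra.to_multiplicative 'rV[int]_n).
Proof.
apply: (@free_abelian_of_embedding X _ (transl \o val)).
  by move=> a b /transl_inj/val_inj.
move=> a b /=; rewrite translM; have /translationsP -> := valP a.
by rewrite twist1.
Qed.

(** Among the elements carrying 0 to multiples of a basis vector, two have the same
    linear part, by the pigeonhole principle; their quotient is a translation. *)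
Lemma translations_unit_vec x :
  exists2 a, a \in translations &
    exists2 n : int, n != 0%R & transl a = (unit_vec x *~ n)%R.
Proof.
have [c cK tK] := transl_bij.
pose h k := c (unit_vec x *+ k)%R.
pose p (k : 'I_#|{perm X}|.+1) := holonomy (h k).
have /injectivePn[i [j ij e]] : ~~ injectiveb p.
  apply/negP=> /injectiveP/leq_card.
  by rewrite card_ord ltnn.
exists (h i * (h j)^-1).
  by apply/translationsP; rewrite holonomyM holonomyV [holonomy (h i)]e mulgV.
exists (i%:Z - j%:Z)%R; first by rewrite subr_eq0.
by rewrite transl_div // !tK mulrzBr.
Qed.

(** Commuting with a translation along the axis of x forces the linear part to
    preserve that axis, hence to fix x. *)
Lemma translations_self_centralizing g :
  {in translations, forall a, commute g a} -> g \in translations.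
Proof.
move=> gC; apply/translationsP/permP=> x; rewrite perm1.
have [a aK [n n0 ta]] := translations_unit_vec x.
have /translationsP a1 := aK.
have := congr1 transl (gC a aK).
rewrite !translM a1 twist1 ta addrC => /addIr/ffunP/(_ x).
rewrite ffunE !unit_vecMz eqxx mul1r; case: eqP => // _.
by rewrite mul0r => /esym/eqP; rewrite (negPf n0).
Qed.

End SimplyTransitive.

(** * Groups given by generators and relations *)

Section UniversalProperty.
Variables (X : choiceType) (R : word X -> word X -> Prop).

Definition pres_gen (x : X) : presented_group R :=
  \pi_(presented_group R) [:: (x, true)].

Lemma pres_genV x : (pres_gen x)^-1 = \pi_(presented_group R) [:: (x, false)].
Proof.
apply: mulg1_eq; rewrite [LHS]pres_mulE.
exact/eqP/pres_eqP/word_eq_cancel.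
Qed.

Lemma pres_ind (P : presented_group R -> Prop) :
    P 1 -> (forall g x, P g -> P (g * pres_gen x)) ->
    (forall g x, P g -> P (g * (pres_gen x)^-1)) ->
  forall g, P g.
Proof.
move=> P1 PM PV; elim/quotW; elim/last_ind=> [//|w [x b] IH].
rewrite -cats1 -[\pi _]pres_mulE.
by case: b; [exact: PM | rewrite -pres_genV; exact: PV].
Qed.

Variables (H : groupType) (f : X -> H).

Definition word_eval (w : word X) : H :=
  \prod_(p <- w) (if p.2 then f p.1 else (f p.1)^-1).

Lemma pres_lift :
    (forall u v, R u v -> word_eval u = word_eval v) ->
  exists F : UMagmaMorphism.type (presented_group R) H,
    forall x, F (pres_gen x) = f x.
Proof.
move=> fR.
have evalP u v : word_eq R u v -> word_eval u = word_eval v.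
  elim=> {u v} // [x b | u v w _ -> //| u u' v v' _ eu _ ev].
    by rewrite /word_eval big_cons big_seq1 big_nil; case: b; rewrite /= ?mulgV ?mulVg.
  by rewrite /word_eval !big_cat /= -!/(word_eval _) eu ev.
pose F (g : presented_group R) := word_eval (repr g).
have FE w : F (\pi_(presented_group R) w) = word_eval w by apply/evalP/pres_repr.
have FM : {morph F : g h / g * h}.
  by elim/quotW=> u; elim/quotW=> v; rewrite [X in F X]pres_mulE !FE /word_eval big_cat.
have F1 : F 1 = 1 by rewrite [LHS]FE /word_eval big_nil.
pose mm := isUMagmaMorphism.Build _ _ F (F1, FM).
pose mF : UMagmaMorphism.type (presented_group R) H := HB.pack F mm.
by exists mF => x; rewrite [LHS]FE /word_eval big_seq1.
Qed.

End UniversalProperty.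

(** * Integer iterates of a bijection *)

Section IntIter.
Variables (T : Type) (f f' : T -> T).
Hypotheses (fK : cancel f f') (fK' : cancel f' f).

Definition iterz (n : int) (t : T) : T :=
  match n with Posz k => iter k f t | Negz k => iter k.+1 f' t end.

Lemma iterzS n t : iterz (n + 1)%R t = f (iterz n t).
Proof.
case: n => [k|[|k]]; first by rewrite -PoszD addn1.
  by rewrite /= fK'.
have -> : (Negz k.+1 + 1 = Negz k)%R by rewrite !NegzE -[k.+2]addn1 PoszD opprD subrK.
by rewrite /= fK'.
Qed.

Lemma iterz_commute (g : T -> T) n t :
  (forall u, g (f u) = f (g u)) -> g (iterz n t) = iterz n (g t).
Proof.
move=> gf; have gf' u : g (f' u) = f' (g u) by rewrite -{2}[u]fK' gf fK.
by case: n => n; rewrite /iterz; [elim: n | elim: n.+1] => //= k <-.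
Qed.

End IntIter.

(** * The structure group acts simply transitively *)

Section StructureGroup.
Variables (X : finType) (s : solution X).
Hypothesis s_inv : involutive s.

Local Notation G := (structure_group s).
Local Notation sg := (sigma_perm s).
Definition gen (x : X) : G := pres_gen _ x.

Lemma sigma_permE x y : sg x y = (s (x, y)).1.
Proof. by rewrite permE. Qed.

(** The first component of r (r (x, y)) = (x, y). *)
Lemma sigma_tau x y : sg (sg x y) (tau s y x) = x.
Proof.
rewrite !sigma_permE /tau.
by have := s_inv (x, y); case: (s (x, y)) => u v /= ->.
Qed.

(** The first component of the braid equation, evaluated at (x, y, z). *)
Lemma sigma_perm_braid x y : sg (tau s y x) * sg (sg x y) = sg y * sg x.
Proof.
apply/permP=> z; rewrite !permM.
have := sol_braid s (x, y, z); rewrite /r12 /r23 /=.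
rewrite !sigma_permE /tau.
case: (s (x, y)) => u v /=.
case: (s (v, z)) => v' w /=.
case: (s (y, z)) => y' z' /=.
case: (s (u, v')) => a b /=.
case: (s (x, y')) => c d /=.
by case: (s (d, z')) => ? ? [-> _ _].
Qed.

(** With z = sigma_x^-1(x), involutivity gives r (x, z) = (x, z), hence
    tau_z(x) = z; so x is recovered from z as the preimage of z under tau_z. *)
Lemma diagonal_inj : injective (fun x => (sg x)^-1 x).
Proof.
have tauP x : tau s ((sg x)^-1 x) x = (sg x)^-1 x.
  have := sigma_tau x ((sg x)^-1 x); rewrite permKV => e.
  by apply: (@perm_inj _ (sg x)); rewrite e permKV.
move=> x y e; apply: (bij_inj (sol_tau_bij s ((sg x)^-1 x))).
by rewrite tauP {1 2}e tauP.
Qed.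

(** The inverse of sigma_x appears because [twist] is contravariant: e_y twisted by
    it is the basis vector at sigma_x(y). *)
Lemma structure_affine :
  exists F : UMagmaMorphism.type G (affine_group X),
    forall x, F (gen x) = (unit_vec x, (sg x)^-1) :> affine_group X.
Proof.
apply: pres_lift => _ _ [x y u v e].
rewrite /word_eval !big_cons big_nil !mulg1 /=.
have uE : u = sg x y by rewrite sigma_permE e.
have vE : v = tau s y x by rewrite /tau e.
have tw a b : twist (unit_vec b) (sg a)^-1 = unit_vec (sg a b).
  by rewrite -{1}(permK (sg a) b) twist_unit_vec.
rewrite /mul /=; congr (_, _) => /=.
  by rewrite !tw uE vE sigma_tau addrC.
by rewrite -!invMg uE vE sigma_perm_braid.
Qed.

Variable F : UMagmaMorphism.type G (affine_group X).
Hypothesis FE : forall x, F (gen x) = (unit_vec x, (sg x)^-1) :> affine_group X.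
Local Notation t := (transl F).
Local Notation hol := (holonomy F).

Lemma transl_gen x : t (gen x) = unit_vec x.
Proof. by rewrite /transl FE. Qed.

Lemma holonomy_gen x : hol (gen x) = (sg x)^-1.
Proof. by rewrite /holonomy FE. Qed.

Let diag_inv := invF diagonal_inj.

(** The action on the set G of the basis vector e_y and of its opposite: they change
    the translation part by e_y and by - e_y. *)
Definition step (y : X) (g : G) : G := g * gen (hol g y).
Definition unstep (y : X) (g : G) : G := g * (gen (diag_inv (hol g y)))^-1.

Lemma stepK y : cancel (step y) (unstep y).
Proof.
move=> g; rewrite /unstep /step holonomyM holonomy_gen permM.
by rewrite /diag_inv invF_f mulgK.
Qed.

Lemma unstepK y : cancel (unstep y) (step y).
Proof.
move=> g; rewrite /unstep /step holonomyM holonomyV holonomy_gen invgK permM.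
set u := diag_inv _.
have -> : hol g y = (sg u)^-1 u by rewrite /u /diag_inv (f_invF diagonal_inj).
by rewrite permKV mulgVK.
Qed.

(** The defining relation of the pair (x, sigma_x^-1(y)), in the symmetric form that
    makes the steps commute. *)
Lemma gen_commute x y : gen x * gen ((sg x)^-1 y) = gen y * gen ((sg y)^-1 x).
Proof.
have yE : (s (x, (sg x)^-1 y)).1 = y by rewrite -sigma_permE permKV.
have := sigma_tau x ((sg x)^-1 y); rewrite permKV => e.
rewrite [LHS]pres_mulE [RHS]pres_mulE; apply/eqP/pres_eqP/word_eq_rel.
have -> : (sg y)^-1 x = tau s ((sg x)^-1 y) x.
  by apply: canLR (permK _) _; rewrite e.
by constructor; rewrite -{2}yE /tau; case: (s _).
Qed.

Lemma stepC y z g : step y (step z g) = step z (step y g).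
Proof.
rewrite /step !holonomyM !holonomy_gen -!mulgA !permM.
by rewrite gen_commute.
Qed.

Lemma transl_step y g : t (step y g) = (t g + unit_vec y)%R.
Proof. by rewrite /step translM transl_gen twist_unit_vec. Qed.

Lemma transl_iterz y n g z :
  t (iterz (step y) (unstep y) n g) z = (t g z + (z == y)%:R * n)%R.
Proof.
have up h : t (step y h) z = (t h z + (z == y)%:R)%R by rewrite transl_step !ffunE.
have down h : t (unstep y h) z = (t h z - (z == y)%:R)%R.
  by rewrite -[in RHS](unstepK y h) up addrK.
have upn k h : t (iter k (step y) h) z = (t h z + (z == y)%:R * k%:Z)%R.
  elim: k => [|k IH]; first by rewrite mulr0 addr0.
  by rewrite iterS up IH -addn1 PoszD mulrDr mulr1 addrA.
have downn k h : t (iter k (unstep y) h) z = (t h z - (z == y)%:R * k%:Z)%R.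
  elim: k => [|k IH]; first by rewrite mulr0 subr0.
  by rewrite iterS down IH -addn1 PoszD mulrDr mulr1 opprD addrA.
by case: n => k; rewrite /iterz ?upn // downn NegzE mulrN.
Qed.

(** The element 1 moved by the part of v supported on l, for l without repetitions;
    when l enumerates X this is the orbit map of 1. *)
Definition lift_vec (l : seq X) (v : {ffun X -> int}) : G :=
  foldr (fun y => iterz (step y) (unstep y) (v y)) 1 l.

Lemma transl_lift_vec l v z :
  uniq l -> t (lift_vec l v) z = if z \in l then v z else 0%R.
Proof.
elim: l => [_|y l IH /= /andP[yl ul]]; first by rewrite /= transl1 ffunE.
rewrite transl_iterz IH // in_cons; case: eqVneq => [->|_] /=.
  by rewrite (negPf yl) add0r mul1r.
by rewrite mul0r addr0.
Qed.

Lemma lift_vecD l v y :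
  uniq l -> y \in l -> lift_vec l (v + unit_vec y)%R = step y (lift_vec l v).
Proof.
have eq_out l' : y \notin l' -> lift_vec l' (v + unit_vec y)%R = lift_vec l' v.
  elim: l' => //= z l' IH; rewrite in_cons negb_or => /andP[yz /IH ->].
  by rewrite !ffunE eq_sym (negPf yz) addr0.
elim: l => //= z l IH /andP[zl ul]; rewrite in_cons !ffunE.
case: eqVneq => [yz _|yz /= /(IH ul) ->].
  rewrite yz in eq_out *. rewrite eq_out //; exact: iterzS (unstepK z) _ _.
rewrite addr0; symmetry; apply: iterz_commute; [exact: stepK| exact: unstepK|].
by move=> u; apply: stepC.
Qed.

(** Lifting a vector after taking the translation part is the identity: both sides
    agree at 1, and multiplying by a generator or by its inverse is a step or
    undoes one. *)
Lemma transl_bijective : bijective t.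
Proof.
pose c := lift_vec (enum X).
have c1 v y : c (v + unit_vec y)%R = step y (c v).
  by apply: lift_vecD; rewrite ?enum_uniq ?mem_enum.
have genE g x : g * gen x = step ((hol g)^-1 x) g by rewrite /step permKV.
exists c => [|v]; last first.
  by apply/ffunP=> z; rewrite transl_lift_vec ?enum_uniq ?mem_enum.
apply: pres_ind => [|g x IH|g x IH].
- rewrite transl1 /c; elim: (enum X) => //= y l ->.
  by rewrite ffunE.
- by rewrite [X in t X]genE transl_step c1 IH -genE.
- set h := g * _; have hE : g = h * gen x by rewrite mulgVK.
  move: IH; rewrite hE genE transl_step c1; exact: can_inj (stepK _) _ _.
Qed.

(** The generator x has linear part sigma_x^-1, and a subgroup contains sigma_x if
    and only if it contains its inverse. *)
Lemma holonomy_image p : p \in permutation_group s <-> exists g, hol g = p.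
Proof.
split=> [|[g <-]]; last first.
  have sP x : sg x \in permutation_group s by apply/mem_gen/imset_f.
  elim/pres_ind: g => [|g x IH|g x IH]; first by rewrite holonomy1 group1.
    by rewrite holonomyM groupM // [hol _]holonomy_gen groupV.
  by rewrite holonomyM groupM // holonomyV groupV [hol _]holonomy_gen groupV.
pose S := [set q | `[< exists g, hol g = q >]].
have gS : group_set S.
  apply/group_setP; split; first by rewrite !inE; exists 1; rewrite holonomy1.
  move=> q q'; rewrite !inE => -[g <-] [h <-].
  by exists (g * h); rewrite holonomyM.
suff /fintype.subsetP sub : permutation_group s \subset Group gS.
  by move=> /sub; rewrite !inE.
rewrite gen_subG; apply/fintype.subsetP=> _ /imsetP[x _ ->].
by rewrite !inE; exists (gen x)^-1; rewrite holonomyV holonomy_gen invgK.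
Qed.

End StructureGroup.

Theorem theorem2p2 (X : finType) (s : solution X) (s_inv : involutive s) :
  exists (n : nat) (A : normalSubgroup (structure_group s)),
    bieberbach n A /\
    isomorphic (quot_group A) (subg_of (permutation_group s)).
Proof.
have [F FE] := structure_affine s_inv.
have tbij := transl_bijective s_inv FE.
have [n rk] := translations_rank tbij.
have iso := quotient_isomorphic (holonomy_image FE).
exists n, (translations F); split=> //; split=> //.
- exact: simply_transitive_torsion_free tbij.
- exact: translations_commute tbij.
- have [f [f' fK _]] := iso.
  apply: (@sub_finite_set _ _ (f' @` [set: _])%classic).
    by move=> u _; exists (f u).
  exact/finite_image/finite_finset.
- apply/seteqP; split=> g /= gP.
    exact: translations_self_centralizing gP.
  by move=> a aA; apply: (translations_commute tbij).
Qed.
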